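(* For $m=1,\dots,d$, let $F_m$ be a cumulative distribution function with $F_m(x)=0$ for $x\le 0$, and let $k_m(r)=\int_0^\infty\max\{0,1-|r|/x\}\,dF_m(x)$. Define the tensor-product kernel $k(u)=\prod_{m=1}^d k_m(u_m)$ for $u=(u_1,\dots,u_d)\in\mathbb{R}^d$. Let $x_1,\dots,x_n\in\mathbb{R}^d$ and $K_{ij}=k(x_i-x_j)$. For each $l=1,\dots,D$, draw independently (across $l$ and $m$) $w^{(l)}_m\sim F_m$ and, conditionally on $w^{(l)}_m$, $b^{(l)}_m\sim\mathcal{U}(0,w^{(l)}_m)$; this defines a random grid on $\mathbb{R}^d$ whose bins are the boxes $\prod_{m=1}^d[b^{(l)}_m+j_m w^{(l)}_m,\,b^{(l)}_m+(j_m+1)w^{(l)}_m)$, $j_m\in\mathbb{Z}$. Let $\widetilde{K}^{(l)}_{ij}=1$ if $x_i$ and $x_j$ lie in the same bin of the $l$-th grid and $\widetilde{K}^{(l)}_{ij}=0$ otherwise. Then \[ E\Big[\tfrac{1}{D}\textstyle\sum_{l=1}^D\widetilde{K}^{(l)}\Big]=K,\qquad E\left[\Big\|\tfrac{1}{D}\textstyle\sum_{l=1}^D\widetilde{K}^{(l)}-K\Big\|_F^2\right]=\tfrac{1}{D}\Big(\textstyle\sum_{i,j=1}^n K_{ij}-\|K\|_F^2\Big). \]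
   Context: This is the random binning feature map: $z(x)$ is the indicator vector of the grid bin containing $x$, and $\widetilde{K}_{ij}=\langle z(x_i),z(x_j)\rangle$. $\|\cdot\|_F$ denotes the Frobenius norm. *)

(* Defs.v *)
From HB Require Import structures.
From mathcomp Require Import all_boot all_order all_algebra.
From mathcomp Require Import all_classical all_reals all_analysis.
Set Implicit Arguments. Unset Strict Implicit. Unset Printing Implicit Defensive.
Import Order.TTheory GRing.Theory Num.Theory.
Local Open Scope classical_set_scope.
Local Open Scope ring_scope.

Definition mutually_indep {dT} {T : measurableType dT} {R : realType}
  (P : probability T R) {I : finType} {dU} {U : measurableType dU}
  (Z : I -> T -> U) : Prop :=
  forall A : I -> set U, (forall i, measurable (A i)) ->
    P (\bigcap_(i in [set: I]) (Z i @^-1` A i)) =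
    \big[*%E/1%E]_(i : I) P (Z i @^-1` A i).

Definition hat_kernel {R : realType} (F : probability R R) (r : R) : R :=
  fine (\int[F]_(x in [set` `]0%R, +oo[]) (Num.max 0 (1 - `|r| / x))%:E)%E.

Definition tensor_kernel {R : realType} {d : nat} (F : 'I_d -> probability R R)
  (u : 'I_d -> R) : R := \prod_(m < d) hat_kernel (F m) (u m).

Definition gram {R : realType} {d n : nat} (F : 'I_d -> probability R R)
  (x : 'I_n -> 'I_d -> R) : 'M[R]_n :=
  \matrix_(i, j) tensor_kernel F (fun m => x i m - x j m).

(* index of the 1-d bin [b + j w, b + (j+1) w) containing y *)
Definition bin_index {R : realType} (w b y : R) : int := Num.floor ((y - b) / w).

Definition same_bin {R : realType} {d : nat} (w b : 'I_d -> R) (y z : 'I_d -> R)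
  : bool := [forall m, bin_index (w m) (b m) (y m) == bin_index (w m) (b m) (z m)].

Definition bin_matrix {R : realType} {d n : nat} (w b : 'I_d -> R)
  (x : 'I_n -> 'I_d -> R) : 'M[R]_n :=
  \matrix_(i, j) (same_bin w b (x i) (x j))%:R.

Definition frob2 {R : realType} {n : nat} (M : 'M[R]_n) : R :=
  \sum_(i < n) \sum_(j < n) M i j ^+ 2.

(* Main.v *)
(* In one dimension, fix a pitch w and write r for the residue of y modulo w and
   s = r + (z - y), where y <= z.  As the offset b sweeps [0, w], the points y and z
   fall in the same bin exactly when s - w < b <= r or s < b, a set of length
   max(0, w - |y - z|); averaging over b and then over w ~ F_m gives k_m(y - z).
   Independence over the coordinates turns the collision probability of x_i and
   x_j in one grid into the product K_ij, and independence over the grids makes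
   the centred entries of distinct grids uncorrelated, so that the mean square
   error is the variance K_ij - K_ij^2 of one Bernoulli entry divided by D. *)
Require Import Defs.
From HB Require Import structures.
From mathcomp Require Import all_boot all_order all_algebra.
From mathcomp Require Import all_classical all_reals all_analysis.
From mathcomp Require Import measurable_realfun ring lra.
Import Order.TTheory GRing.Theory Num.Theory.
Import numFieldNormedType.Exports.
Local Open Scope classical_set_scope.
Local Open Scope ring_scope.

(** * Measurability of the collision event in one dimension *)

Lemma measurable_inv (R : realType) : measurable_fun setT (@GRing.inv R).
Proof.
(* Inversion is continuous off 0, and any function is measurable on a singleton. *)
have <- : ~` [set 0 : R] `|` [set 0 : R] = setT by rewrite setUC setUv.
apply/measurable_funU; [exact: measurableC|exact: measurable_set1|split].
  apply: open_continuous_measurable_fun.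
    by rewrite openC; exact: closed_eq.
  by move=> x /set_mem /eqP x0; exact: inv_continuous.
exact: measurable_fun_set1.
Qed.

(** Splitting by the common index [k] gives a countable union, each piece being the intersection of
    two preimages of [[k, k + 1)]. *)
Lemma measurable_same_bin1 (R : realType) (y z : R) :
  measurable [set p : R * R | bin_index p.1 p.2 y == bin_index p.1 p.2 z].
Proof.
pose f (v : R) (p : R * R) := (v - p.2) / p.1.
have mf v : measurable_fun setT (f v).
  apply: measurable_funM; first exact: measurable_funB.
  by apply: measurableT_comp; [exact: measurable_inv|exact: measurable_fst].
pose A v (k : int) := f v @^-1` `[k%:~R, (k + 1)%:~R[.
have mA v k : measurable (A v k) by rewrite -[A v k]setTI; exact: mf.
have -> : [set p : R * R | bin_index p.1 p.2 y == bin_index p.1 p.2 z] =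
    \bigcup_k (A y k `&` A z k).
  apply/seteqP; split => [p /= /eqP pyz|p [k _ [/= yk zk]]].
    by exists (bin_index p.1 p.2 y) => //; split; rewrite /A /= in_itv/=;
       [|rewrite pyz]; exact: floor_itv.
  rewrite /A /= in_itv/= -floor_eq in yk; rewrite /A /= in_itv/= -floor_eq in zk.
  move: yk zk => /eqP yk /eqP zk.
  by rewrite /bin_index yk zk.
apply: countable_bigcupT_measurable => // k; exact: measurableI.
Qed.

(** * Length of the set of colliding offsets for a fixed pitch *)

Lemma same_bin1_section (R : realType) (w y z : R) : 0 < w -> y <= z ->
  let r := y - (Num.floor (y / w))%:~R * w in let s := r + (z - y) in
  [set b | bin_index w b y == bin_index w b z] `&` `[0, w] =
  (if s < w then `[0, r] `|` `]s, w] else `]s - w, r])%classic.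
Proof.
move=> w0 yz r s.
have /andP[] := floor_itv (y / w).
rewrite ler_pdivlMr// ltr_pdivrMr// intrD mulrDl mul1r.
set k := Num.floor _ => ky yk.
have r0 : 0 <= r by rewrite subr_ge0.
have rw : r < w by rewrite /r; lra.
have rs : r <= s by rewrite /s; lra.
have bE b : 0 <= b <= w -> (bin_index w b y == bin_index w b z) =
    (s - w < b <= r) || (s < b).
  move=> /andP[b0 bw].
  (* The index of [y] is [k] if [b <= r] and [k - 1] if [r < b]. As [z = k w + s], the point [z] has
     the same index exactly when [s - w < b] in the first case and [s < b] in the second. *)
  have [br|rb] := leP b r.
    have -> : bin_index w b y = k.
      apply/eqP; rewrite floor_eq ler_pdivlMr// ltr_pdivrMr// intrD mulrDl mul1r.
      by move: br; rewrite /r => br; apply/andP; split; lra.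
    rewrite eq_sym floor_eq ler_pdivlMr// ltr_pdivrMr// intrD mulrDl mul1r.
    rewrite [s < b]ltNge (le_trans br rs) /= orbF andbT.
    rewrite (_ : (_ <= z - b) = true); last by move: br; rewrite /r => br; lra.
    by rewrite /= -subr_gt0 -[RHS]subr_gt0; congr (0 < _); rewrite /s /r; lra.
  have -> : bin_index w b y = k - 1.
    apply/eqP; rewrite floor_eq ler_pdivlMr// ltr_pdivrMr// subrK intrB mulrBl mul1r.
    by move: rb; rewrite /r => rb; apply/andP; split; lra.
  rewrite eq_sym floor_eq ler_pdivlMr// ltr_pdivrMr// subrK intrB mulrBl mul1r.
  rewrite andbF /=.
  rewrite (_ : (_ <= z - b) = true) /=; last by lra.
  by rewrite -subr_gt0 -[RHS]subr_gt0; congr (0 < _); rewrite /s /r; lra.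
(* If [s < w], then [s - w < b] is automatic for [0 <= b]; otherwise [s < b] is impossible for
   [b <= w]. *)
case: ifPn => [sw|]; last rewrite -leNgt => ws; apply/seteqP; split => b /=.
- move=> [+ /[!in_itv]/= bw]; rewrite bE// => /orP[/andP[_ br]|sb].
    by left; rewrite br andbT; case/andP: bw.
  by right; rewrite sb; case/andP: bw.
- rewrite !in_itv/= => bw.
  have bw' : 0 <= b <= w by case: bw => /andP[? ?]; apply/andP; split; lra.
  split => //; rewrite bE//; case: bw => /andP[? ?]; apply/orP; [left|right] => //.
  by apply/andP; split; lra.
- move=> [+ /[!in_itv]/= bw]; rewrite bE// => /orP[//|sb].
  by case/andP: bw => _ bw; move: (le_lt_trans ws sb); rewrite ltNge bw.
- rewrite !in_itv/= => /andP[? ?].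
  have bw' : 0 <= b <= w by apply/andP; split; lra.
  by split => //; rewrite bE//; apply/orP; left; apply/andP; split.
Qed.

Lemma lebesgue_bounded_itv (R : realType) (a b : R) (c d : bool) : a <= b ->
  lebesgue_measure [set` Interval (BSide c a) (BSide d b)] = (b - a)%:E.
Proof.
rewrite lebesgue_measure_itv/= lte_fin le_eqVlt => /orP[/eqP ->|->//].
by rewrite ltxx subrr.
Qed.

Lemma lebesgue_same_bin1 (R : realType) (w y z : R) : 0 < w ->
  lebesgue_measure ([set b | bin_index w b y == bin_index w b z] `&` `[0, w]) =
  (Num.max 0 (w - `|y - z|))%:E.
Proof.
move=> w0; wlog yz : y z / y <= z => [hw|].
  have [|/ltW zy] := leP y z; first exact: hw.
  rewrite distrC -hw//; congr (lebesgue_measure (_ `&` _)).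
  by apply/seteqP; split => b /=; rewrite eq_sym.
rewrite same_bin1_section// distrC ger0_norm ?subr_ge0//.
have /andP[] := floor_itv (y / w).
rewrite ler_pdivlMr// ltr_pdivrMr// intrD mulrDl mul1r.
set r := y - _ => ky yk; pose s := r + (z - y); rewrite -/s.
have sE : s = r + (z - y) by [].
have r0 : 0 <= r by rewrite subr_ge0.
have rw : r < w by rewrite /r; lra.
clear ky yk.
(* The floor is abstracted away: what follows is linear arithmetic from [s = r + (z - y)] and
   [0 <= r < w]. *)
move: (r) (s) sE r0 rw => {}r {}s sE r0 rw.
case: ifPn => [sw|]; last rewrite -leNgt => ws.
  rewrite measureU//; last first.
    by apply/seteqP; split => // b [] /=; rewrite !in_itv/= => /andP[? ?] /andP[? ?]; lra.
  rewrite /= !lebesgue_bounded_itv// ?(ltW sw)// subr0 max_r; last by lra.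
  by rewrite -EFinD; congr EFin; lra.
(* In the second case [w < z - y], so the interval is empty and the maximum is 0. *)
have [h|h] := leP (s - w) r.
  by rewrite lebesgue_bounded_itv// max_r; [congr EFin; lra|lra].
rewrite set_itv_ge ?measure0; last by rewrite bnd_simp -leNgt ltW.
by rewrite max_l//; lra.
Qed.

(** * The law of pitch and offset as a measure on the plane *)

Section grid_law.
Local Open Scope ereal_scope.
Context {R : realType} (F : probability R R).

Definition triangle : set (R * R) := [set p | (0 <= p.2 <= p.1)%R].

Lemma measurable_triangle : measurable triangle.
Proof.
have -> : triangle = (setT `&` [set p | (cst 0 p <= p.2)%R]) `&`
    (setT `&` [set p | (p.2 <= p.1)%R]).
  apply/seteqP; split => p /=; rewrite /triangle/=; first by move=> /andP[].
  by move=> [[_ ->] [_ ->]].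
by apply: measurableI; apply: measurable_fun_le.
Qed.

Lemma xsection_triangle (w : R) : xsection triangle w = `[0%R, w]%classic.
Proof. by apply/seteqP; split => b; rewrite /xsection/= inE/= in_itv. Qed.

(** For [w > 0], this is the probability that [(w, b)] lies in [C] when [b] is uniform on
    [[0, w]]. *)
Definition grid_density (C : set (R * R)) (w : R) : \bar R :=
  lebesgue_measure (xsection (C `&` triangle) w) * (w^-1)%:E.

(** A negative pitch makes [w^-1] negative, but the section of [triangle] is then empty. *)
Lemma grid_density_ge0 C w : 0 <= grid_density C w.
Proof.
rewrite /grid_density; have [w0|w0] := leP 0%R w.
  by rewrite mule_ge0// lee_fin invr_ge0.
rewrite (_ : xsection _ _ = set0) ?measure0 ?mul0e//.
rewrite -subset0 => b; rewrite /xsection/= inE => -[_ /=].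
by rewrite /triangle/= => /andP[? ?]; lra.
Qed.

Lemma measurable_grid_density C : measurable C ->
  measurable_fun setT (grid_density C).
Proof.
move=> mC; apply: emeasurable_funM.
  apply: (@measurable_fun_xsection _ _ _ _ _ lebesgue_measure).
  by apply: measurableI => //; exact: measurable_triangle.
by apply/measurable_EFinP; exact: measurable_inv.
Qed.

(* The law of (w, b) for w ~ F and b ~ U(0, w) given w; the mass of F on w <= 0 is
   lost, the sections of the triangle being null there. *)
Definition grid_law (C : set (R * R)) : \bar R := \int[F]_w grid_density C w.

Let grid_law0 : grid_law set0 = 0.
Proof.
rewrite /grid_law; under eq_integral do
  rewrite /grid_density set0I xsection0 measure0 mul0e.
exact: integral0.
Qed.

Let grid_law_ge0 C : 0 <= grid_law C.
Proof. by apply: integral_ge0 => w _; exact: grid_density_ge0. Qed.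

(** Series and integral commute for nonnegative terms, which leaves the additivity of Lebesgue
    measure on disjoint sections. *)
Let grid_law_sigma_additive : semi_sigma_additive grid_law.
Proof.
move=> A mA tA mUA.
have mAt n : measurable (A n `&` triangle).
  by apply: measurableI => //; exact: measurable_triangle.
rewrite [X in _ --> X](_ : _ = \sum_(n <oo) grid_law (A n)).
  by apply/cvg_closeP; split; [exact: is_cvg_nneseries|rewrite closeE].
rewrite -integral_nneseries//.
- apply: eq_integral => w _; rewrite /grid_density setI_bigcupl xsection_bigcup.
  under eq_eseriesr do rewrite muleC.
  rewrite nneseriesZl// muleC; congr (_ * _); apply/esym/cvg_lim => //=.
  apply: (@measure_sigma_additive _ _ _ lebesgue_measure) => [n|].
    exact: (measurable_xsection w (mAt n)).
  by apply: trivIset_xsection; under eq_fun do rewrite setIC; exact: trivIset_setIl.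
- by move=> n; exact: measurable_grid_density.
- by move=> n w _; exact: grid_density_ge0.
Qed.

HB.instance Definition _ := isMeasure.Build _ _ _ grid_law
  grid_law0 grid_law_ge0 grid_law_sigma_additive.

Lemma grid_lawX (A S : set R) : measurable A -> measurable S ->
  grid_law (A `*` S) =
  \int[F]_(w in A) (lebesgue_measure (S `&` [set` `[0%R, w]]) * (w^-1)%:E).
Proof.
move=> mA mS; rewrite integral_mkcond; apply: eq_integral => w _.
rewrite /grid_density patchE xsectionI xsection_triangle.
case: ifPn => wA; first by rewrite in_xsectionX.
by rewrite notin_xsectionX// set0I measure0 mul0e.
Qed.

End grid_law.

(** * Collision probability in one coordinate of one grid *)

Section joint_law.
Local Open Scope ereal_scope.
Context {R : realType} {F : probability R R}.
Context {d : measure_display} {T : measurableType d} {P : probability T R}.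
Context {W B : T -> R}.
Hypotheses (mW : measurable_fun setT W) (mB : measurable_fun setT B).
Hypothesis WB : forall A S : set R, measurable A -> measurable S ->
  P (W @^-1` A `&` B @^-1` S) =
  \int[F]_(w in A) (lebesgue_measure (S `&` [set` `[0%R, w]]) * (w^-1)%:E).

(** Hypothesis [WB] gives the law of the pair on rectangles only. They form a generating class
    closed under intersection and containing the whole plane, so two finite measures agreeing on
    them coincide. *)
Lemma joint_lawE (C : set (R * R)) : measurable C ->
  P ((fun t => (W t, B t)) @^-1` C) = grid_law F C.
Proof.
move=> mC; have mWB := measurable_fun_pair mW mB.
pose Z : {mfun T >-> (R * R)%type} :=
  HB.pack (fun t => (W t, B t)) (isMeasurableFun.Build _ _ _ _ _ mWB).
pose G := [set A `*` S | A in measurable & S in measurable] : set (set (R * R)).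
apply: (measure_unique G (fun=> setT) _ _ _ _ (distribution P Z) (grid_law F)) => //.
- exact: measurable_prod_measurableType.
- move=> _ _ [A1 mA1 [S1 mS1 <-]] [A2 mA2 [S2 mS2 <-]].
  rewrite -setXI; exists (A1 `&` A2); first exact: measurableI.
  by exists (S1 `&` S2) => //; exact: measurableI.
- by move=> _; exists setT => //; exists setT => //; rewrite setXTT.
- by rewrite bigcup_const.
- by move=> _ [A mA [S mS <-]]; rewrite /= grid_lawX// -WB.
- by move=> _; rewrite -ge0_fin_numE// fin_num_measure.
Qed.

Lemma same_bin1_probability (y z : R) : F [set` `]-oo, 0%R]] = 0 ->
  P [set t | bin_index (W t) (B t) y == bin_index (W t) (B t) z] =
  (hat_kernel F (y - z))%:E.
Proof.
move=> F0; pose E := [set p : R * R | bin_index p.1 p.2 y == bin_index p.1 p.2 z].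
have mE : measurable E by exact: measurable_same_bin1.
rewrite -[LHS]/(P ((fun t => (W t, B t)) @^-1` E)).
rewrite joint_lawE//.
(* The integral equals a probability, so it is finite and [fine] in [hat_kernel] preserves it. *)
suff FE : grid_law F E =
    \int[F]_(w in [set` `]0%R, +oo[]) (Num.max 0 (1 - `|y - z| / w))%R%:E.
  rewrite /hat_kernel -FE fineK// -joint_lawE//.
  apply: fin_num_measure; rewrite -[X in measurable X]setTI.
  exact: measurable_fun_pair.
have mN : measurable `]-oo, 0%R : R]%classic by exact: measurable_itv.
rewrite /grid_law.
(* By [F0] the half-line [w <= 0] is null; removing it leaves the domain of integration of
   [hat_kernel]. *)
rewrite [LHS](@ge0_negligible_integral _ _ _ F setT _ (grid_density E) mN _ _ _ F0)//;
  last 2 first.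
- exact: measurable_grid_density.
- by move=> w _; exact: grid_density_ge0.
rewrite setTD setCitvl; apply: eq_integral => w.
rewrite inE/= in_itv/= andbT => w0; rewrite /grid_density xsectionI xsection_triangle.
have -> : xsection E w = [set b | bin_index w b y == bin_index w b z].
  by apply/seteqP; split => b; rewrite /xsection/= inE.
rewrite lebesgue_same_bin1// -EFinM; congr EFin.
by rewrite maxr_pMl ?invr_ge0 ?ltW// mul0r mulrBl divff ?gt_eqF.
Qed.

End joint_law.

(** * Linearity of expectation *)

Section has_expectation.
Context {d : measure_display} {T : measurableType d} {R : realType}.
Context (P : probability T R).

(** Integrability is bundled with the value so that the predicate is stable under linear
    combinations. *)
Definition has_expectation (X : T -> R) (v : R) : Prop :=
  P.-integrable setT (EFin \o X) /\ ('E_P[X] = v%:E)%E.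

Lemma has_expectation_indic (A : set T) (v : R) : measurable A -> P A = v%:E ->
  has_expectation \1_A v.
Proof.
move=> mA PA; split; last by rewrite expectation_indic.
by apply: integrable_indic => //; rewrite PA ltry.
Qed.

Lemma has_expectation_cst (v : R) : has_expectation (cst v) v.
Proof.
split; last exact: expectation_cst.
by apply: finite_measure_integrable_cst.
Qed.

Lemma has_expectationZ (k : R) (X : T -> R) (v : R) :
  has_expectation X v -> has_expectation (fun t => k * X t) (k * v).
Proof.
move=> [iX EX]; split; first exact: (integrableZl measurableT k iX).
rewrite unlock; under eq_integral do rewrite EFinM.
by rewrite integralZl// EFinM -EX unlock.
Qed.

Lemma has_expectationD (X Y : T -> R) (v w : R) : has_expectation X v ->
  has_expectation Y w -> has_expectation (fun t => X t + Y t) (v + w).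
Proof.
move=> [iX EX] [iY EY]; split; first exact: (integrableD measurableT iX iY).
rewrite unlock; under eq_integral do rewrite EFinD.
by rewrite integralD// EFinD -EX -EY unlock.
Qed.

Lemma has_expectation_sum (I : Type) (r : seq I) (X : I -> T -> R) (v : I -> R) :
  (forall i, has_expectation (X i) (v i)) ->
  has_expectation (fun t => \sum_(i <- r) X i t) (\sum_(i <- r) v i).
Proof.
move=> Xv; elim: r => [|i r IH].
  rewrite big_nil (_ : (fun t => _) = cst 0); first exact: has_expectation_cst.
  by apply/funext => t; rewrite big_nil.
rewrite big_cons (_ : (fun t => _) = (fun t => X i t + \sum_(j <- r) X j t)).
  exact: has_expectationD.
by apply/funext => t; rewrite big_cons.
Qed.

End has_expectation.

(** * Moments of the collision indicators over several grids *)

Section random_binning.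
Context {R : realType} {d n D : nat} (F : 'I_d -> probability R R).
Hypothesis F0 : forall m, F m [set` `]-oo, 0%R]] = 0%E.
Context (x : 'I_n -> 'I_d -> R).
Context {dT : measure_display} {T : measurableType dT} (P : probability T R).
Context (W B : 'I_D -> 'I_d -> T -> R).
Hypothesis mW : forall l m, measurable_fun setT (W l m).
Hypothesis mB : forall l m, measurable_fun setT (B l m).
Hypothesis WB_indep : mutually_indep P
  (fun p : 'I_D * 'I_d => fun t => (W p.1 p.2 t, B p.1 p.2 t)).
Hypothesis WB_law : forall l m (A S : set R), measurable A -> measurable S ->
  P (W l m @^-1` A `&` B l m @^-1` S) =
  (\int[F m]_(w in A) (lebesgue_measure (S `&` [set` `[0%R, w]]) * (w^-1)%:E))%E.

Let Kt (l : 'I_D) (t : T) : 'M[R]_n :=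
  bin_matrix (fun m => W l m t) (fun m => B l m t) x.

(** Taking a set of grids treats at once a single entry, [L = [set l]], and a product of two
    entries, [L = [set l; l']]. *)
Definition joint_collision (L : {set 'I_D}) (i j : 'I_n) : set T :=
  [set t | forall l, l \in L ->
     same_bin (fun m => W l m t) (fun m => B l m t) (x i) (x j)].

Let E (i j : 'I_n) (m : 'I_d) : set (R * R) :=
  [set p | bin_index p.1 p.2 (x i m) == bin_index p.1 p.2 (x j m)].

(** Grids outside [L] receive [setT], because [mutually_indep] speaks of events indexed by the whole
    family. *)
Let A (L : {set 'I_D}) (i j : 'I_n) (p : 'I_D * 'I_d) : set (R * R) :=
  if p.1 \in L then E i j p.2 else setT.

Let mA L i j p : measurable (A L i j p).
Proof. by rewrite /A; case: ifP => // _; exact: measurable_same_bin1. Qed.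

Let joint_collisionE L i j : joint_collision L i j =
  \bigcap_(p in [set: 'I_D * 'I_d])
    ((fun t => (W p.1 p.2 t, B p.1 p.2 t)) @^-1` A L i j p).
Proof.
apply/seteqP; split => [t Lt [l m] _ /=|t Lt l lL].
  by rewrite /A/=; case: ifPn => // /Lt /forallP /(_ m).
by apply/forallP => m; have := Lt (l, m) Logic.I; rewrite /A/= lL.
Qed.

Lemma measurable_joint_collision L i j : measurable (joint_collision L i j).
Proof.
rewrite joint_collisionE; apply: fin_bigcap_measurable => // p _.
by rewrite -[X in measurable X]setTI; exact: measurable_fun_pair.
Qed.

(** By independence each grid in [L] contributes the product of the [hat_kernel] values, that is the
    Gram entry, and each other grid contributes 1. *)
Lemma joint_collision_probability L i j :
  P (joint_collision L i j) = (gram F x i j ^+ #|L|)%:E.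
Proof.
rewrite joint_collisionE WB_indep//.
pose q (p : 'I_D * 'I_d) : R :=
  if p.1 \in L then hat_kernel (F p.2) (x i p.2 - x j p.2) else 1.
have -> : \big[*%E/1%E]_p P ((fun t => (W p.1 p.2 t, B p.1 p.2 t)) @^-1` A L i j p) =
    (\prod_p q p)%:E.
  rewrite (big_morph EFin (@EFinM R) (erefl _)); apply: eq_bigr => -[l m] _.
  rewrite /q /A/=; case: ifPn => _; last by rewrite preimage_setT probability_setT.
  exact: (same_bin1_probability (mW l m) (mB l m) (WB_law l m)).
congr EFin; rewrite -(pair_bigA _ (fun l m => q (l, m)))/= -prodr_const.
rewrite [RHS]big_mkcond/=; apply: eq_bigr => l _; rewrite /q/=.
case: ifPn => _; last exact: big1_eq.
by rewrite mxE.
Qed.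

Lemma bin_matrixE l t i j : Kt l t i j = \1_(joint_collision [set l] i j) t.
Proof.
rewrite mxE indicE; congr (_%:R); congr nat_of_bool.
apply/idP/idP => [h|]; last by rewrite inE => /(_ l); apply; rewrite inE.
by rewrite inE => l'; rewrite inE => /eqP ->.
Qed.

Lemma bin_matrixM l l' t i j :
  Kt l t i j * Kt l' t i j = \1_(joint_collision [set l; l'] i j) t.
Proof.
rewrite !bin_matrixE -[LHS]/((\1_ _ \* \1_ _) t) -indicI; congr (\1_ _ t).
apply/seteqP; split => s /= => [[h h'] k|h].
  by rewrite !inE => /orP[] /eqP ->; [apply: h|apply: h']; rewrite inE.
by split => k; rewrite inE => /eqP ->; apply: h; rewrite !inE eqxx ?orbT.
Qed.

Lemma has_expectation_bin_matrix l i j :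
  has_expectation P (fun t => Kt l t i j) (gram F x i j).
Proof.
under eq_fun do rewrite bin_matrixE.
apply: has_expectation_indic; first exact: measurable_joint_collision.
by rewrite joint_collision_probability cards1.
Qed.

(** Expanding the product reduces the claim to the mean of one indicator over [[set l; l']], which
    is [k] if [l = l'] and [k ^+ 2] otherwise. *)
Lemma has_expectation_covariance l l' i j (k := gram F x i j) :
  has_expectation P (fun t => (Kt l t i j - k) * (Kt l' t i j - k))
    (if l == l' then k - k ^+ 2 else 0).
Proof.
have -> : (fun t => (Kt l t i j - k) * (Kt l' t i j - k)) =
    (fun t => (\1_(joint_collision [set l; l'] i j) t + (- k) * Kt l t i j) +
              ((- k) * Kt l' t i j + cst (k ^+ 2) t)).
  by apply/funext => t; rewrite -bin_matrixM/=; ring.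
(* The exponent [(l != l').+1] is the cardinality of [[set l; l']]. *)
have -> : (if l == l' then k - k ^+ 2 else 0) =
    (k ^+ (l != l').+1 + (- k) * k) + ((- k) * k + k ^+ 2).
  by case: eqP => _; rewrite /= ?expr1; ring.
apply: has_expectationD; apply: has_expectationD.
- apply: has_expectation_indic; first exact: measurable_joint_collision.
  by rewrite joint_collision_probability cards2.
- exact/has_expectationZ/has_expectation_bin_matrix.
- exact/has_expectationZ/has_expectation_bin_matrix.
- exact: has_expectation_cst.
Qed.

End random_binning.

(** * Mean and mean square error of the averaged matrix *)

Theorem theorem7 (R : realType) (d n D : nat) (hD : (0 < D)%N)
  (F : 'I_d -> probability R R)
  (hF0 : forall m, F m [set` `]-oo, 0%R]] = 0%E)
  (x : 'I_n -> 'I_d -> R)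
  (dT : measure_display) (T : measurableType dT) (P : probability T R)
  (W B : 'I_D -> 'I_d -> T -> R)
  (hWmeas : forall l m, measurable_fun setT (W l m))
  (hBmeas : forall l m, measurable_fun setT (B l m))
  (hindep : mutually_indep P
     (fun p : 'I_D * 'I_d => fun t => (W p.1 p.2 t, B p.1 p.2 t)))
  (hlaw : forall l m (A S : set R), measurable A -> measurable S ->
     P (W l m @^-1` A `&` B l m @^-1` S) =
     (\int[F m]_(w in A)
        (lebesgue_measure (S `&` [set` `[0%R, w]]) * (w^-1)%:E))%E) :
  let Kt := fun (l : 'I_D) (t : T) =>
    bin_matrix (fun m => W l m t) (fun m => B l m t) x in
  let Kbar := fun t : T => D%:R^-1 *: \sum_(l < D) Kt l t in
  let K := gram F x in
  (forall i j, ('E_P[fun t => Kbar t i j] = (K i j)%:E)%E) /\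
  ('E_P[fun t => frob2 (Kbar t - K)] =
    ((D%:R)^-1 * (\sum_(i < n) \sum_(j < n) K i j - frob2 K))%:E)%E.
Proof.
move=> Kt Kbar K.
have D0 : D%:R != 0 :> R by rewrite pnatr_eq0 -lt0n.
have EKt l i j : has_expectation P (fun t => Kt l t i j) (K i j).
  exact: has_expectation_bin_matrix.
have KbarE t i j : Kbar t i j = D%:R^-1 * \sum_(l < D) Kt l t i j.
  by rewrite mxE summxE.
split=> [i j|].
  have : has_expectation P (fun t => D%:R^-1 * \sum_(l < D) Kt l t i j)
      (D%:R^-1 * \sum_(l < D) K i j).
    exact/has_expectationZ/has_expectation_sum.
  rewrite sumr_const card_ord -[K i j *+ D]mulr_natl mulKf// => -[_ <-].
  by congr ('E_P[_])%E; apply/funext => t; rewrite KbarE.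
(* Writing [K i j] as the average of [D] copies of itself turns the squared error into a double sum
   of centred products. *)
have KbarK t i j : (Kbar t - K) i j ^+ 2 = D%:R^-1 ^+ 2 *
    \sum_(l < D) \sum_(l' < D) (Kt l t i j - K i j) * (Kt l' t i j - K i j).
  under eq_bigr do rewrite -mulr_sumr.
  rewrite -mulr_suml -expr2 -exprMn sumrB sumr_const card_ord -[K i j *+ D]mulr_natl.
  by rewrite mulrBr mulKf// mxE KbarE mxE.
suff [_ <-] : has_expectation P (fun t => frob2 (Kbar t - K))
    (D%:R^-1 * (\sum_(i < n) \sum_(j < n) K i j - frob2 K)) by [].
rewrite /frob2 -sumrB mulr_sumr; apply: has_expectation_sum => i.
rewrite -sumrB mulr_sumr; apply: has_expectation_sum => j.
under eq_fun do rewrite KbarK.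
set v := K i j - K i j ^+ 2.
(* Only the [D] diagonal pairs contribute, which cancels one of the two factors [D%:R^-1]. *)
have -> : D%:R^-1 * v = D%:R^-1 ^+ 2 *
    \sum_(l < D) \sum_(l' < D) (if l == l' then v else 0).
  under eq_bigr => l _ do under eq_bigr => l' _ do rewrite eq_sym.
  under eq_bigr => l _ do rewrite -big_mkcond big_pred1_eq.
  by rewrite sumr_const card_ord -[v *+ D]mulr_natl expr2 -mulrA mulKf.
apply: has_expectationZ; apply: has_expectation_sum => l.
by apply: has_expectation_sum => l'; exact: has_expectation_covariance.
Qed.
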